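(* (1) We have $K = \mathbb{Q}(\sqrt{\theta_1}, \sqrt{\theta_2}, \sqrt{\theta_3}, \sqrt{\theta_4})$ if $(Z,2) = 1$, and $K = \mathbb{Q}(\sqrt{\theta_1'}, \sqrt{\theta_2'}, \sqrt{\theta_3'}, \sqrt{\theta_4'}) = \mathbb{Q}(\sqrt{\eta_1}, \sqrt{\eta_2}, \sqrt{\eta_3}, \sqrt{\eta_4})$ if $(Y,2) = 1$. (2) The extension $K/\mathbb{Q}$ is a Galois extension whose Galois group is isomorphic to $N_{4}(\mathbb{F}_2)$, the group of $4\times 4$ unipotent upper-triangular matrices over $\mathbb{F}_2$.
   Context: Let $p_1,p_2,p_3$ be prime numbers with $p_i \equiv 1 \pmod 4$, Legendre symbols $\left(\frac{p_i}{p_j}\right)=1$ for $i\neq j$, and Rédei triple symbols $[p_i,p_j,p_k]=1$ for $\{i,j,k\}=\{1,2,3\}$. Assume moreover $p_1 \equiv 5 \pmod 8$ and that $k=\mathbb{Q}(\sqrt{p_1})$ has class number $1$. Put $k_{13}=\mathbb{Q}(\sqrt{p_1},\sqrt{p_3})$. Fix a prime $\mathfrak{p}_2$ of $\mathcal{O}_k$ over $p_2$ and integers $x,y,z$ with $x^2-p_1y^2-p_2z^2=0$, $\gcd(x,y,z)=1$, $y\equiv 0 \pmod 2$, $x-y\equiv 1\pmod 4$, and $\alpha = x+y\sqrt{p_1}$ satisfying $(\alpha)=\mathfrak{p}_2^m$ with $m$ odd; put $k_{13}'=\mathbb{Q}(\sqrt{p_1},\sqrt{\alpha})$. Fix $X,Y,Z\in\mathcal{O}_k$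 with $X^2-p_3Y^2-\alpha Z^2=0$, $\gcd(X,Y,Z)=1$, and either $(Z,2)=1$ and there is $\lambda\in\mathcal{O}_{k_{13}}$ with $\lambda^2\equiv X+Y\sqrt{p_3} \pmod 4$, or $(Y,2)=1$ and there is $\lambda\in\mathcal{O}_{k_{13}'}$ with $\lambda^2\equiv X+Z\sqrt{\alpha}\pmod 4$ (such a triple exists under these assumptions). Writing $\overline{X},\overline{Y},\overline{Z},\overline{\alpha}$ for the conjugates of $X,Y,Z,\alpha$ under $\sqrt{p_1}\mapsto-\sqrt{p_1}$, set $\theta_1=X+Y\sqrt{p_3}$, $\theta_2=X-Y\sqrt{p_3}$, $\theta_3=\overline{X}+\overline{Y}\sqrt{p_3}$, $\theta_4=\overline{X}-\overline{Y}\sqrt{p_3}$; $\theta_1'=X+Z\sqrt{\alpha}$, $\theta_2'=X-Z\sqrt{\alpha}$, $\theta_3'=\overline{X}+\overline{Z}\sqrt{\overline{\alpha}}$, $\theta_4'=\overline{X}-\overline{Z}\sqrt{\overline{\alpha}}$; and (for $(Y,2)=1$) $\eta_1=(\sqrt{\theta_1'}+\sqrt{\theta_2'})^2=2X+2Y\sqrt{p_3}$, $\eta_2=(\sqrt{\theta_1'}-\sqrt{\theta_2'})^2=2X-2Y\sqrt{p_3}$, $\eta_3=(\sqrt{\theta_3'}+\sqrt{\theta_4'})^2=2\overline{X}+2\overline{Y}\sqrt{p_3}$, $\eta_4=(\sqrt{\theta_3'}-\sqrt{\theta_4'})^2=2\overline{X}-2\overline{Y}\sqrt{p_3}$. Define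 $K=\mathbb{Q}(\sqrt{p_1},\sqrt{p_2},\sqrt{p_3},\sqrt{\theta_1\theta_2},\sqrt{\theta_1\theta_3},\sqrt{\theta_1})$ if $(Z,2)=1$, and $K=\mathbb{Q}(\sqrt{p_1},\sqrt{p_2},\sqrt{p_3},\sqrt{\theta_1'\theta_2'},\sqrt{\theta_1'\theta_3'},\sqrt{\theta_1'})$ if $(Y,2)=1$. *)

(* Defs.v *)
From HB Require Import structures.
From mathcomp Require Import all_boot all_order all_algebra all_fingroup.
From mathcomp Require Import all_solvable all_field.
From mathcomp Require Import boolp.

Set Implicit Arguments.
Unset Strict Implicit.
Unset Printing Implicit Defensive.

Import Order.TTheory GRing.Theory Num.Theory.
Local Open Scope ring_scope.

(* Number fields are subfields of algC, given by their membership predicates. *)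

(* Q(s), as the intersection of all subfields of algC containing s. *)
Definition Qadj (s : seq algC) : {pred algC} := fun z =>
  `[< forall F : {pred algC},
        divring_closed F -> {subset s <= F} -> z \in F >].

Definition ringint (F : {pred algC}) : {pred algC} :=
  fun z => (z \in F) && (z \in Aint).

Section Integers.

Variable F : {pred algC}.

Definition dvdF (d a : algC) : Prop := exists2 b, b \in ringint F & a = d * b.

(* gcd = 1 in the ring of integers: every common divisor is a unit. *)
Definition coprimeF (s : seq algC) : Prop :=
  forall d, d \in ringint F -> (forall a, a \in s -> dvdF d a) -> dvdF d 1.

Definition eqmodF (n a b : algC) : Prop := dvdF n (a - b).

Definition is_ideal (I : {pred algC}) : Prop :=
  [/\ {subset I <= ringint F}, 0 \in I,
      {in I &, forall a b, a + b \in I}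
    & {in ringint F & I, forall c a, c * a \in I}].

Definition nonzero_ideal (I : {pred algC}) : Prop :=
  is_ideal I /\ exists2 a, a \in I & a != 0.

Definition prime_ideal (P : {pred algC}) : Prop :=
  [/\ is_ideal P, 1 \notin P
    & {in ringint F &, forall a b, a * b \in P -> a \in P \/ b \in P}].

Definition prime_over (p : nat) (P : {pred algC}) : Prop :=
  prime_ideal P /\ p%:R \in P.

Definition principal (a : algC) : {pred algC} := fun z => `[< dvdF a z >].

Definition mul_ideal (I J : {pred algC}) : {pred algC} := fun z =>
  `[< exists2 s : seq (algC * algC),
        (forall u, u \in s -> u.1 \in I /\ u.2 \in J)
      & z = \sum_(u <- s) u.1 * u.2 >].

Definition exp_ideal (I : {pred algC}) (n : nat) : {pred algC} :=
  iter n (mul_ideal I) (ringint F).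

Definition ideal_equiv (I J : {pred algC}) : Prop :=
  exists a b : algC,
    [/\ a \in ringint F, b \in ringint F, a != 0, b != 0
      & mul_ideal (principal a) I =i mul_ideal (principal b) J].

Definition class_number_is (h : nat) : Prop :=
  exists C : 'I_h -> {pred algC},
    [/\ forall i, nonzero_ideal (C i),
        forall i j, ideal_equiv (C i) (C j) -> i = j
      & forall I, nonzero_ideal I -> exists i, ideal_equiv I (C i)].

(* Every prime P over p has residue degree 1 (Z maps onto O_F / P) and        *)
(* ramification index 1 (P^2 does not divide p).                              *)
Definition splits_completely (p : nat) : Prop :=
  forall P, prime_over p P ->
    {in ringint F, forall a, exists n : int, a - n%:~R \in P}
    /\ p%:R \notin exp_ideal P 2.

End Integers.

Definition legendre (a p : nat) : int :=
  if (p %| a)%N then 0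
  else if [exists b : 'I_p, (b ^ 2 == a %[mod p])%N] then 1 else -1.

Definition redei_solution (p q : nat) (x y z : int) : Prop :=
  [/\ x ^+ 2 - p%:Z * y ^+ 2 - q%:Z * z ^+ 2 = 0,
      gcdz x (gcdz y z) = 1,
      (y = 0 %[mod 2])%Z
    & (x - y = 1 %[mod 4])%Z].

Definition redei_alpha (p : nat) (x y : int) : algC :=
  x%:~R + y%:~R * sqrtC p%:R.

(* [p, q, r] = 1 iff r is completely decomposed in the Redei extension        *)
(* Q(sqrt p, sqrt q, sqrt alpha); for primes p, q = 1 mod 4 with (p/q) = 1    *)
(* this field exists and does not depend on the solution (x, y, z).           *)
Definition redei_symbol (p q r : nat) : int :=
  if `[< exists x y z : int, redei_solution p q x y z /\
         splits_completely
           (Qadj [:: sqrtC p%:R; sqrtC q%:R; sqrtC (redei_alpha p x y)]) r >]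
  then 1 else -1.

(* The conjugation a + b sqrt d |-> a - b sqrt d of Q(sqrt d), d not a        *)
(* square; the value outside Q(sqrt d) is irrelevant.                         *)
Definition qconj (d : nat) (z : algC) : algC :=
  if pselect (exists ab : rat * rat,
                z == ratr ab.1 + ratr ab.2 * sqrtC d%:R) is left h
  then ratr (xchoose h).1 - ratr (xchoose h).2 * sqrtC d%:R
  else z.

Definition N4F2_set : {set {'GL_4(2)}} :=
  [set g : {'GL_4(2)} | [forall i : 'I_4, forall j : 'I_4,
     (j <= i)%N ==> (GLval g i j == (i == j)%:R)]].

Lemma N4F2_group_set : group_set N4F2_set.
Proof.
apply/group_setP; split.
  rewrite inE; apply/forallP=> i; apply/forallP=> j; apply/implyP=> _.
  by rewrite GL_1E /= mxE.
move=> g h; rewrite !inE => /'forall_'forall_implyP Hg.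
move=> /'forall_'forall_implyP Hh.
apply/forallP=> i; apply/forallP=> j; apply/implyP=> le_ji.
rewrite GL_ME /= mxE (bigD1 i) //= big1 ?addr0 => [|k ne_ki].
  by rewrite (eqP (Hg i i (leqnn _))) eqxx mul1r (eqP (Hh i j le_ji)).
have [lt_ki|le_ik] := ltnP k i.
  by rewrite (eqP (Hg i k (ltnW lt_ki))) eq_sym (negPf ne_ki) mul0r.
rewrite (eqP (Hh k j (leq_trans le_ji le_ik))).
case: eqP => [ekj|]; last by rewrite mulr0.
by case/negP: ne_ki; rewrite -val_eqE /= eqn_leq le_ik andbT ekj.
Qed.

Canonical N4F2 : {group {'GL_4(2)}} := Group N4F2_group_set.

(* K / Q is Galois with group isomorphic to G: the subfield K of algC is the  *)
(* image of an abstract finite extension L of Q that is Galois with group G.  *)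
Definition galois_with_group (K : {pred algC}) (gT : finGroupType)
    (G : {group gT}) : Prop :=
  exists (L : splittingFieldType rat) (f : {rmorphism L -> algC}),
    [/\ forall z, z \in K <-> exists a : L, z = f a,
        galois 1 {:L}
      & 'Gal({:L} / 1) \isog G].

(* Main.v *)
Require Import Defs.
From HB Require Import structures.
From mathcomp Require Import all_boot all_order all_algebra all_fingroup.
From mathcomp Require Import all_solvable all_field.
From mathcomp Require Import boolp ring.

Import Order.TTheory GRing.Theory Num.Theory.
Local Open Scope ring_scope.

(* Let r_(s,t), with (s,t) in F_2 x F_2, be square roots of the four conjugates *)
(* theta_(s,t) of X + Y sqrt p3, where s is the sign of sqrt p1 and t the sign  *)
(* of sqrt p3. An automorphism permutes the r_(s,t) up to signs, through the    *)
(* regular action of V_4 = F_2 x F_2, so the Galois group of Q(r_(s,t))         *)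
(* embeds in F_2 wr V_4, which is N_4(F_2). The product of the four roots is a  *)
(* rational multiple of sqrt p2, hence the three superdiagonal entries of the   *)
(* image are the characters of sqrt p1, sqrt p2 and sqrt p3. As p1, p2, p3 are  *)
(* distinct primes, these characters are jointly onto F_2^3, and a subgroup of  *)
(* N_4(F_2) which maps onto the quotient F_2^3 is everything. When (Y,2) = 1,   *)
(* the eta_i = 2 theta_i are the conjugates attached to (2X, 2Y, 2Z), and       *)
(* Q(sqrt theta'_1, sqrt theta'_2) = Q(sqrt eta_1, sqrt eta_2).                 *)

(** * The group N_4(F_2) as a wreath product *)

(** Two lemmas carry the group theory. [wreath_isog] turns a sign cocycle [e] over two characters
    [s], [t] into unitriangular matrices; [N4F2_sub] shows that a subgroup realizing every
    superdiagonal is all of [N4F2]. [wreath_galois_isog] supplies the cocycle from the action on the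
    roots, and [sep_chi] the independence of the three characters, by comparing p-adic valuations.

    The arithmetic is gathered in [theta_field]: X^2 - p3 Y^2 = alpha Z^2 and N(alpha) = p2 z^2 make
    the product of the four thetas p2 times a nonzero rational square, and put sqrt p1, sqrt p2,
    sqrt p3 in the field of the roots. The theorem uses it for (X, Y, Z) and for (2X, 2Y, 2Z);
    [sqrtC_sum_in] and [sqrtC_sum_inV] pass between the roots of the theta' and of the eta. *)

Definition unitri4 (a b c d e f : 'F_2) : 'M['F_2]_4 :=
  \matrix_(i, j) nth 0 (nth [::] [:: [:: 1; a; d; f]; [:: 0; 1; b; e];
                                     [:: 0; 0; 1; c]; [:: 0; 0; 0; 1]] i) j.

(** The parameters are listed diagonal by diagonal, so the superdiagonal (a, b, c) is visibly a
    homomorphism to F_2^3. *)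
Lemma unitri4M a b c d e f a' b' c' d' e' f' :
  unitri4 a b c d e f *m unitri4 a' b' c' d' e' f' =
  unitri4 (a + a') (b + b') (c + c') (d' + a * b' + d) (e' + b * c' + e)
    (f' + a * e' + d * c' + f).
Proof.
apply/matrixP=> i j; rewrite !mxE !big_ord_recl big_ord0 !mxE.
case: i => [[|[|[|[|//]]]] lti]; case: j => [[|[|[|[|//]]]] ltj] /=; ring.
Qed.

Lemma unitri4_1 : unitri4 0 0 0 0 0 0 = 1%:M.
Proof.
apply/matrixP=> i j; rewrite !mxE.
by case: i => [[|[|[|[|//]]]] lti]; case: j => [[|[|[|[|//]]]] ltj].
Qed.

Lemma unitri4_unit a b c d e f : unitri4 a b c d e f \is a GRing.unit.
Proof.
suff: unitri4 a b c d e f \in unitmx by [].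
(* The inverse is found by solving [unitri4M] for the identity, one diagonal after the other. *)
pose g := unitri4 (- a) (- b) (- c) (a * b - d) (b * c - e)
  (a * e + d * c - a * b * c - f).
suff: unitri4 a b c d e f *m g = 1%:M by case/mulmx1_unit.
by rewrite /g unitri4M -unitri4_1; congr unitri4; ring.
Qed.

Definition unitri4_GL a b c d e f : {'GL_4(2)} :=
  FinRing.unit 'M['F_2]_4 (unitri4_unit a b c d e f).

Lemma unitri4_GLM a b c d e f a' b' c' d' e' f' :
  (unitri4_GL a b c d e f * unitri4_GL a' b' c' d' e' f')%g =
  unitri4_GL (a + a') (b + b') (c + c') (d' + a * b' + d) (e' + b * c' + e)
    (f' + a * e' + d * c' + f).
Proof. by apply: val_inj; exact: unitri4M. Qed.

Lemma unitri4_GL_N4F2 a b c d e f : unitri4_GL a b c d e f \in N4F2.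
Proof.
rewrite inE; apply/'forall_'forall_implyP=> i j; rewrite /= /GLval /= mxE.
by case: i => [[|[|[|[|//]]]] lti]; case: j => [[|[|[|[|//]]]] ltj].
Qed.

Lemma N4F2P g : g \in N4F2 ->
  exists a b c d e f, g = unitri4_GL a b c d e f.
Proof.
rewrite inE => /'forall_'forall_implyP g_tri.
pose o k : 'I_4 := inord k; pose v i j := GLval g (o i) (o j).
exists (v 0 1), (v 1 2), (v 2 3), (v 0 2), (v 1 3), (v 0 3).
apply: val_inj; apply/matrixP=> i j; rewrite mxE.
have vE i' j' : val g i' j' = v i' j' by rewrite /v /o !inord_val.
have v0 (i' j' : 'I_4) (le_ji : (j' <= i')%N) : v i' j' = (i' == j')%:R.
  by rewrite /v /o !inord_val; apply/eqP/g_tri.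
have [le_ji | lt_ij] := leqP j i.
  rewrite vE v0 //; move: le_ji.
  by case: i => [[|[|[|[|//]]]] lti]; case: j => [[|[|[|[|//]]]] ltj].
rewrite vE; move: lt_ij.
by case: i => [[|[|[|[|//]]]] lti]; case: j => [[|[|[|[|//]]]] ltj].
Qed.

Lemma F2_case (a : 'F_2) : a = 0 \/ a = 1.
Proof. by case: a => [[|[|//]] lta]; [left | right]; apply: val_inj. Qed.

(* The commutators of the lifts fill the subgroup with zero superdiagonal. *)
Lemma N4F2_sub (H : {group {'GL_4(2)}}) :
  (forall a b c, exists d e f, unitri4_GL a b c d e f \in H) -> N4F2 \subset H.
Proof.
move=> liftH.
have divH a b c d e f d' e' f' :
    unitri4_GL a b c d e f \in H -> unitri4_GL a b c d' e' f' \in H ->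
  unitri4_GL 0 0 0 (d - d') (e - e') (f - f' - (d - d') * c) \in H.
  move=> Hx Hx'; rewrite -(groupMr _ Hx') unitri4_GLM.
  suff -> : unitri4_GL (0 + a) (0 + b) (0 + c) (d' + 0 * b + (d - d'))
    (e' + 0 * c + (e - e')) (f' + 0 * e' + (d - d') * c +
    (f - f' - (d - d') * c)) = unitri4_GL a b c d e f by [].
  by congr unitri4_GL; ring.
have [d1 [e1 [f1 H1]]] := liftH 1 0 0.
have [d2 [e2 [f2 H2]]] := liftH 0 1 0.
have [d3 [e3 [f3 H3]]] := liftH 0 0 1.
(* The products in both orders have the same superdiagonal, so [divH] yields the commutator. Its
   corner entry is needed only when the second factor has zero superdiagonal. *)
have comH a b c d e f a' b' c' d' e' f' :
    unitri4_GL a b c d e f \in H -> unitri4_GL a' b' c' d' e' f' \in H ->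
  exists f'', unitri4_GL 0 0 0 (a * b' - a' * b) (b * c' - b' * c) f'' \in H /\
    (a' = 0 -> b' = 0 -> c' = 0 -> f'' = a * e' - c * d').
  move=> Hx Hx'; have := groupM Hx' Hx; have := groupM Hx Hx'.
  rewrite !unitri4_GLM [a' + a]addrC [b' + b]addrC [c' + c]addrC => Hxx' Hx'x.
  have := divH _ _ _ _ _ _ _ _ _ Hxx' Hx'x; set f'' := (X in unitri4_GL _ _ _ _ _ X).
  move=> Hc; exists f''; split=> [|a0 b0 c0]; last first.
    by rewrite /f'' a0 b0 c0; ring.
  by congr (unitri4_GL _ _ _ _ _ _ \in H): Hc; ring.
(* [H4] and [H5] have a single 1 on the second diagonal and an unknown corner; the commutator [H6]
   has a single 1, in the corner. Hence corner, [d] and [e] become free in this order. *)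
have [f4 [H4 _]] := comH _ _ _ _ _ _ _ _ _ _ _ _ H1 H2.
have [f5 [H5 _]] := comH _ _ _ _ _ _ _ _ _ _ _ _ H2 H3.
have [f6 [H6 /(_ erefl erefl erefl) Df6]] := comH _ _ _ _ _ _ _ _ _ _ _ _ H1 H5.
have {H6 Df6} Hf f : unitri4_GL 0 0 0 0 0 f \in H.
  have [-> | ->] := F2_case f.
    suff -> : unitri4_GL 0 0 0 0 0 0 = 1%g by exact: group1.
    by apply: val_inj; exact: unitri4_1.
  by congr (unitri4_GL _ _ _ _ _ _ \in H): H6; rewrite ?Df6; ring.
have {H4} Hd d f : unitri4_GL 0 0 0 d 0 f \in H.
  have [-> | ->] := F2_case d; first exact: Hf.
  have := groupM H4 (Hf (f - f4)); rewrite unitri4_GLM => Hm.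
  by congr (unitri4_GL _ _ _ _ _ _ \in H): Hm; ring.
have {H5} He d e f : unitri4_GL 0 0 0 d e f \in H.
  have [-> | ->] := F2_case e; first exact: Hd.
  have := groupM H5 (Hd d (f - f5)); rewrite unitri4_GLM => Hm.
  by congr (unitri4_GL _ _ _ _ _ _ \in H): Hm; ring.
apply/subsetP=> g /N4F2P[a [b [c [d [e [f ->]]]]]].
have [d0 [e0 [f0 H0]]] := liftH a b c.
have := groupM (He (d - d0) (e - e0) (f - f0 - (d - d0) * c)) H0.
rewrite unitri4_GLM => Hm.
by congr (unitri4_GL _ _ _ _ _ _ \in H): Hm; ring.
Qed.

Lemma unitri4_GL_inj a b c d e f a' b' c' d' e' f' :
  unitri4_GL a b c d e f = unitri4_GL a' b' c' d' e' f' ->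
  [/\ a = a', b = b' & c = c'] /\ [/\ d = d', e = e' & f = f'].
Proof.
move/(congr1 val)/matrixP=> eq_mx.
have eq_at (i j : nat) := eq_mx (inord i : 'I_4) (inord j : 'I_4).
move: (eq_at 0%N 1%N) (eq_at 1%N 2) (eq_at 2 3) (eq_at 0%N 2) (eq_at 1%N 3)
  (eq_at 0%N 3).
by rewrite !mxE !inordK.
Qed.

Lemma F2_addb (a b : bool) : (a (+) b)%:R = a%:R + b%:R :> 'F_2.
Proof. by apply: val_inj; case: a; case: b. Qed.

Lemma F2_andb (a b : bool) : (a && b)%:R = a%:R * b%:R :> 'F_2.
Proof. by apply: val_inj; case: a; case: b. Qed.

Lemma F2_bool_eq0 (b : bool) : b%:R = 0 :> 'F_2 -> b = false.
Proof. by case: b => // /eqP. Qed.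

Lemma F2_boolP (a : 'F_2) : exists b : bool, a = b%:R.
Proof. by have [-> | ->] := F2_case a; [exists false | exists true]. Qed.

(* The hypotheses present G as a subgroup of F_2 wr V_4 = F_2[V_4] x| V_4, with *)
(* (s, t) the component in V_4 and e the one in F_2[V_4]. The isomorphism is     *)
(* the block matrix [[U, C V], [0, V]], with U = [[1, s], [0, 1]], V = [[1, t],  *)
(* [0, 1]] and C the sum over (i, j) of e i j times the rank one matrix          *)
(* (i, 1)^T (1, j): V_4 permutes these four matrices by C |-> U C V^-1.          *)
Lemma wreath_isog (gT : finGroupType) (G : {group gT}) (s t : gT -> bool)
    (e : gT -> bool -> bool -> bool)
    (q := fun x => e x false false (+) e x false true (+)
                   (e x true false (+) e x true true)) :
    {in G &, forall x y, s (x * y)%g = s x (+) s y} ->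
    {in G &, forall x y, t (x * y)%g = t x (+) t y} ->
    {in G &, forall x y i j,
       e (x * y)%g i j = e x i j (+) e y (i (+) s x) (j (+) t x)} ->
    {in G, forall x, s x = false -> t x = false ->
       (forall i j, e x i j = false) -> x = 1%g} ->
    (forall a b c, exists2 x, x \in G & [/\ s x = a, q x = b & t x = c]) ->
  G \isog N4F2.
Proof.
move=> sM tM eM inj_e lift_q.
(* The rows of C are ([c1], [e x true true]) and ([q], [c2]); the upper right block of [phi] is C
   V. *)
pose c1 x := e x true false (+) e x true true.
pose c2 x := e x false true (+) e x true true.
pose phi x := unitri4_GL (s x)%:R (q x)%:R (t x)%:R (c1 x)%:R
  ((q x && t x) (+) c2 x)%:R ((c1 x && t x) (+) e x true true)%:R.
have phiM : {in G &, {morph phi : x y / (x * y)%g}}.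
  move=> x y Gx Gy; rewrite /phi unitri4_GLM /c1 /c2 /q !eM // sM // tM //.
  rewrite -!F2_andb -!F2_addb.
  (* Since [e y] is read at indices shifted by [s x] and [t x], splitting on these two bits leaves
     Boolean identities in finitely many values. *)
  move: (e x) (e y) (s x) (s y) (t x) (t y) => u v sx sy tx ty.
  clear; congr unitri4_GL; congr (_%:R); case: sx; case: tx => //=;
    move: (u false false) (u false true) (u true false) (u true true)
      (v false false) (v false true) (v true false) (v true true);
    clear u v; intros;
    repeat match goal with b : bool |- context [?c] =>
      constr_eq b c; destruct b end; reflexivity.
pose f := Morphism phiM.
have injf : ('injm f)%g.
  apply/injmP=> x y Gx Gy eq_f; apply/eqP; rewrite eq_mulVg1; apply/eqP.
  have Gz : (x^-1 * y)%g \in G by rewrite groupM ?groupV.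
  have f1 : f (x^-1 * y)%g = f 1%g.
    by rewrite morphM ?groupV // morphV // eq_f -morphV // -morphM ?groupV // mulVg.
  have : f (x^-1 * y)%g = unitri4_GL 0 0 0 0 0 0.
    rewrite f1 morph1; apply: val_inj; symmetry; exact: unitri4_1.
  move: Gz; move: (x^-1 * y)%g => z Gz.
  case/unitri4_GL_inj => -[/F2_bool_eq0 sz /F2_bool_eq0 qz /F2_bool_eq0 tz].
  case=> /F2_bool_eq0 c1z /F2_bool_eq0 c2z /F2_bool_eq0 ez.
  (* The entries of C determine [e]: the corner gives [e z true true], then [c1], [c2] and [q] give
     one more value each. *)
  apply: inj_e => //; move: qz c1z c2z ez; rewrite /c1 /c2 /q tz !andbF !addFb.
  move=> + + + e11; rewrite e11 !addbF => + e10; rewrite e10 addbF => + e01.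
  by rewrite e01 addbF => e00 [] [].
apply/isogP; exists f => //; apply/eqP; rewrite eqEsubset; apply/andP; split.
  by apply/subsetP=> _ /morphimP[x _ Gx ->]; apply: unitri4_GL_N4F2.
apply: N4F2_sub => a b c.
have [[a' ->] [b' ->] [c' ->]] := And3 (F2_boolP a) (F2_boolP b) (F2_boolP c).
have [x Gx [<- <- <-]] := lift_q a' b' c'.
exists (c1 x)%:R, ((q x && t x) (+) c2 x)%:R, ((c1 x && t x) (+) e x true true)%:R.
by rewrite -[X in X \in _]/(f x) mem_morphim.
Qed.

(** * The Galois group of the field generated by the four square roots *)

(** A subspace of F_2^3 on which no nonzero linear form vanishes is everything: an echelon basis is
    built, each vector obtained from a form vanishing on the previous ones. *)
Lemma F2_cube_full (P : bool -> bool -> bool -> Prop) :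
    (forall a b c a' b' c', P a b c -> P a' b' c' ->
       P (a (+) a') (b (+) b') (c (+) c')) ->
    (forall u v w, [|| u, v | w] -> exists a b c,
       P a b c /\ (u && a) (+) (v && b) (+) (w && c)) ->
  forall a b c, P a b c.
Proof.
move=> addP sepP.
have addkP k a b c a' b' c' : P a b c -> P a' b' c' ->
    P (a (+) (k && a')) (b (+) (k && b')) (c (+) (k && c')).
  by case: k => Px Py; [exact: addP | rewrite !addbF].
have [b1 [c1 P1]] : exists b1 c1, P true b1 c1.
  by have [[] [b [c [Px //]]]] := sepP true false false isT; exists b, c.
(* The form (b1, 1, 0) vanishes at the first basis vector, so clearing the first coordinate keeps
   its value 1. *)
have [c2 P2] : exists c2, P false true c2.
  have [a [b [c [Px sep_x]]]] := sepP b1 true false (orbT _).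
  exists (c (+) (a && c1)); have Py := addkP a _ _ _ _ _ _ Px P1.
  by congr (P _ _ _): Py; move: a b b1 {Px P1} sep_x; do 3![case].
(* The form (c1 + b1 c2, c2, 1) vanishes at both basis vectors found so far. *)
have P3 : P false false true.
  have [|a [b [c [Px sep_x]]]] := sepP (c1 (+) (b1 && c2)) c2 true.
    by rewrite !orbT.
  have Py := addkP (b (+) (a && b1)) _ _ _ _ _ _ (addkP a _ _ _ _ _ _ Px P1) P2.
  by congr (P _ _ _): Py; move: a b c b1 c1 c2 {Px P1 P2} sep_x; do 6![case].
have P0 := addP _ _ _ _ _ _ P3 P3.
move=> a b c.
have Px := addkP (c (+) (a && c1) (+) ((b (+) (a && b1)) && c2)) _ _ _ _ _ _
  (addkP (b (+) (a && b1)) _ _ _ _ _ _ (addkP a _ _ _ _ _ _ P0 P1) P2) P3.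
by congr (P _ _ _): Px; move: a b c b1 c1 c2 {P0 P1 P2}; do 6![case].
Qed.

(** Compare the valuations in num(u)^2 = n den(u)^2; n = 0 is covered by the convention
    [logn p 0 = 0]. *)
Lemma rat_sqr_logn (p n : nat) (u : rat) :
  prime p -> u ^+ 2 = n%:R -> odd (logn p n) = false.
Proof.
move=> p_pr u2.
have [-> | n_gt0] := posnP n; first by rewrite logn0.
have u0 : u != 0.
  by apply: contra_eq_neq u2 => ->; rewrite expr0n eq_sym pnatr_eq0 -lt0n.
have: (`|numq u| ^ 2 = n * `|denq u| ^ 2)%N.
  suff /(congr1 absz): numq u ^+ 2 = n%:Z * denq u ^+ 2.
    by rewrite abszM !abszX absz_nat.
  apply: (@intr_inj rat); rewrite [in RHS]rmorphM !rmorphXn /= -[n%:~R]u2.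
  by rewrite -{2}[u]divq_num_den expr_div_n divfK // expf_neq0 // intr_eq0 denq_neq0.
move/(congr1 (fun k => odd (logn p k))).
rewrite lognM ?expn_gt0 ?absz_gt0 ?denq_neq0 // !lognX !oddM /= oddD oddM.
by rewrite !addbF; case: (odd (logn p n)).
Qed.

(** Flipping the signs of the two square roots multiplies them into the signs that index the
    conjugate of theta. *)
Fact sign_twist (R : comPzRingType) (a b c d s t u v q q' : R) :
  a + s * b * (u * q) + t * (c + s * d * (u * q)) * (v * q') =
  a + (s * u) * b * q + t * v * (c + (s * u) * d * q) * q'.
Proof. ring. Qed.

Fact mulr3ACA (R : comPzRingType) (s t u a b c : R) :
  (s * a) * (t * b) * (u * c) = (s * t * u) * (a * b * c).
Proof. ring. Qed.

Section WreathGalois.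

Variables (L : splittingFieldType rat) (p1 p2 p3 : nat).
Hypotheses (pr1 : prime p1) (pr2 : prime p2) (pr3 : prime p3).
Hypotheses (ne12 : p1 != p2) (ne13 : p1 != p3) (ne23 : p2 != p3).
Variables (q1 q2 q3 : L).
Hypotheses (sqr1 : q1 ^+ 2 = p1%:R) (sqr2 : q2 ^+ 2 = p2%:R).
Hypothesis sqr3 : q3 ^+ 2 = p3%:R.
Variables (a b c d w : rat) (r : bool -> bool -> L).
Hypothesis sqr_r : forall i j, r i j ^+ 2 =
  (a%:A + (-1) ^+ i * b%:A * q1) + (-1) ^+ j * (c%:A + (-1) ^+ i * d%:A * q1) * q3.
Hypothesis r0 : forall i j, r i j != 0.
Hypothesis prod_r :
  r false false * r false true * (r true false * r true true) = w%:A * q2.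
Hypothesis w0 : w != 0.
Hypothesis gen_r :
  <<1 & [:: r false false; r false true; r true false; r true true]>>%VS
    = fullv.
Hypothesis galL : galois 1 {:L}.

Let G : {group gal_of {:L}} := 'Gal({:L} / 1)%G.

Let neg1_neq1 : -1 != 1 :> L.
Proof.
have <- : (-1)%:A = -1 :> L by rewrite scaleNr scale1r.
by rewrite -[X in _ != X]scale1r (inj_eq (fmorph_inj (in_alg L))).
Qed.

Let sgn_inj (v : L) (i j : bool) :
  v != 0 -> (-1) ^+ i * v = (-1) ^+ j * v -> i = j.
Proof.
move=> v0 /(mulIf v0); case: i; case: j => // /eqP; rewrite expr0 expr1.
  by rewrite (negPf neg1_neq1).
by rewrite eq_sym (negPf neg1_neq1).
Qed.

Let sgnE (u v : L) : u ^+ 2 = v ^+ 2 -> u = (-1) ^+ (u != v) * v.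
Proof.
move/eqP; rewrite eqf_sqr; case: eqVneq => [-> _|ne_uv /eqP->].
  by rewrite mul1r.
by rewrite mulN1r.
Qed.

Let galA (x : gal_of {:L}) (u : rat) : x (u%:A : L) = u%:A.
Proof. by rewrite linearZ /= rmorph1. Qed.

Let gal_nat (x : gal_of {:L}) n : x (n%:R : L) = n%:R.
Proof. exact: rmorph_nat. Qed.

Let chi (q : L) (x : gal_of {:L}) : bool := x q != q.

Let chiE (q : L) n (x : gal_of {:L}) : q ^+ 2 = n%:R -> x q = (-1) ^+ chi q x * q.
Proof. by move=> q2E; apply: sgnE; rewrite -rmorphXn q2E /= gal_nat. Qed.

Let q_neq0 (q : L) p : prime p -> q ^+ 2 = p%:R -> q != 0.
Proof.
move=> p_pr; apply: contra_eq_neq => ->; rewrite expr0n /= eq_sym.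
have <- : (p%:R)%:A = p%:R :> L by rewrite scaler_nat.
by rewrite -in_algE fmorph_eq0 pnatr_eq0 -lt0n prime_gt0.
Qed.

Let chiM (q : L) p x y : prime p -> q ^+ 2 = p%:R ->
  chi q (x * y)%g = chi q x (+) chi q y.
Proof.
move=> p_pr q2E; apply: (sgn_inj q); first exact: q_neq0 q2E.
rewrite -(chiE _ _ _ q2E) galM ?memvf // (chiE _ _ _ q2E) rmorphM rmorph_sign /=.
by rewrite (chiE _ _ _ q2E) mulrA -signr_addb.
Qed.

(** An automorphism sends the root at (i, j) to plus or minus the root at the index shifted by the
    characters of sqrt p1 and sqrt p3; [e] records that sign. *)
Let e (x : gal_of {:L}) i j := x (r i j) != r (i (+) chi q1 x) (j (+) chi q3 x).

Let eE (x : gal_of {:L}) i j :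
  x (r i j) = (-1) ^+ e x i j * r (i (+) chi q1 x) (j (+) chi q3 x).
Proof.
apply: sgnE; rewrite -rmorphXn !sqr_r /= !(rmorphD, rmorphM, rmorph_sign) /=.
rewrite !galA (chiE _ _ _ sqr1) (chiE _ _ _ sqr3) !signr_addb.
exact: sign_twist.
Qed.

Let eM x y i j :
  e (x * y)%g i j = e x i j (+) e y (i (+) chi q1 x) (j (+) chi q3 x).
Proof.
apply: (sgn_inj _ _ _ (r0 (i (+) chi q1 (x * y)%g) (j (+) chi q3 (x * y)%g))).
rewrite -eE galM ?memvf // eE rmorphM rmorph_sign /= eE.
by rewrite (chiM _ _ _ _ pr1 sqr1) (chiM _ _ _ _ pr3 sqr3) !addbA mulrA -signr_addb.
Qed.

(** Apply x to [prod_r]: the roots are permuted, so their product changes exactly by the four signs,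
    while the right side changes by the character of sqrt p2. *)
Let chi2E x : e x false false (+) e x false true (+)
  (e x true false (+) e x true true) = chi q2 x.
Proof.
apply: (sgn_inj (w%:A * q2)).
  by rewrite mulf_neq0 ?(q_neq0 _ _ pr2 sqr2) // -in_algE fmorph_eq0.
rewrite [RHS]mulrCA -(chiE _ _ _ sqr2) -[in RHS](galA x) -[RHS]rmorphM -prod_r.
rewrite /= !rmorphM /= !eE !signr_addb.
have -> : r false false * r false true * (r true false * r true true) =
    r (false (+) chi q1 x) (false (+) chi q3 x) *
    r (false (+) chi q1 x) (true (+) chi q3 x) *
    (r (true (+) chi q1 x) (false (+) chi q3 x) *
     r (true (+) chi q1 x) (true (+) chi q3 x)).
  case: (chi q1 x); case: (chi q3 x) => //=.
  - by rewrite mulrC; congr (_ * _); apply: mulrC.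
  - exact: mulrC.
  - by congr (_ * _); apply: mulrC.
by rewrite mulrACA; congr (_ * _); exact: mulrACA.
Qed.

(** Otherwise the product of the selected [q1], [q2], [q3] is fixed by G, hence rational, although
    its square is a nonempty product of distinct primes. *)
Let sep_chi u1 u2 u3 : [|| u1, u2 | u3] ->
  exists2 x, x \in G & (u1 && chi q1 x) (+) (u2 && chi q2 x) (+) (u3 && chi q3 x).
Proof.
move=> nz_u; apply/exists_inP; apply: contraT => /exists_inPn fix_u.
have: q1 ^+ u1 * q2 ^+ u2 * q3 ^+ u3 \in 1%VS.
  have <- := galois_fixedField galL.
  apply/fixedFieldP=> [|x /fix_u/negPf]; first exact: memvf.
  rewrite !(rmorphM, rmorphXn) /=.
  rewrite (chiE _ _ _ sqr1) (chiE _ _ _ sqr2) (chiE _ _ _ sqr3) => fix_x.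
  have sgnX (u v : bool) (q : L) :
      ((-1) ^+ v * q) ^+ u = (-1) ^+ (u && v) * q ^+ u.
    by case: u => /=; rewrite ?expr1 ?expr0 ?mulr1.
  rewrite !sgnX mulr3ACA -!signr_addb fix_x.
  exact: mul1r.
case/vlineP=> u Du; pose n := (p1 ^ u1 * p2 ^ u2 * p3 ^ u3)%N.
have u2n : u ^+ 2 = n%:R.
  apply: (fmorph_inj (in_alg L)); rewrite rmorphXn rmorph_nat /= -Du /n.
  rewrite !exprMn !natrM !natrX -!exprM !(mulnC _ 2) !exprM.
  by rewrite sqr1 sqr2 sqr3.
have logn_n p : prime p -> logn p n =
    (u1 * (p == p1) + u2 * (p == p2) + u3 * (p == p3))%N.
  move=> p_pr; rewrite /n !lognM ?muln_gt0 ?expn_gt0 ?prime_gt0 //.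
  by rewrite !lognX !logn_prime.
have := rat_sqr_logn _ _ _ pr1 u2n; have := rat_sqr_logn _ _ _ pr2 u2n.
have := rat_sqr_logn _ _ _ pr3 u2n; rewrite !logn_n //.
rewrite !eqxx (eq_sym p2 p1) (eq_sym p3 p1) (eq_sym p3 p2).
rewrite (negPf ne12) (negPf ne13) (negPf ne23).
by move: nz_u; case: (u1); case: (u2); case: (u3).
Qed.

Lemma wreath_galois_isog : G \isog N4F2.
Proof.
apply: (wreath_isog _ _ (chi q1) (chi q3) e).
- by move=> x y _ _; apply: chiM pr1 sqr1.
- by move=> x y _ _; apply: chiM pr3 sqr3.
- by move=> x y _ _ i j; apply: eM.
- move=> x _ s0 t0 e0; have fix_r i j : x (r i j) = r i j.
    by rewrite eE e0 s0 t0 !addbF mul1r.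
  apply/eqP/gal_eqP=> v _; rewrite gal_id.
  (* The fixed field of x contains the four generating roots, hence all of L. *)
  suff: v \in fixedField [set x].
    by move/(fixedFieldP (memvf v)); apply; rewrite inE.
  have: v \in <<1 & [:: r false false; r false true; r true false; r true true]>>%VS.
    by rewrite gen_r memvf.
  apply/subvP/Fadjoin_seqP; split=> [|z]; first exact: sub1v.
  rewrite !inE => /or4P[]/eqP->; apply/fixedFieldP; rewrite ?memvf // => y;
  by rewrite inE => /eqP->.
move=> a' b' c'; pose P s q t := exists2 x, x \in G &
  [/\ chi q1 x = s, chi q2 x = q & chi q3 x = t].
suff [x Gx [<- <- <-]] : P a' b' c' by exists x => //; rewrite chi2E.
apply: F2_cube_full => [s q t s' q' t' [x Gx [<- <- <-]] [y Gy [<- <- <-]]|].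
  exists (x * y)%g; first exact: groupM.
  by rewrite (chiM _ _ _ _ pr1) // (chiM _ _ _ _ pr2) // (chiM _ _ _ _ pr3).
move=> u1 u2 u3 /sep_chi[x Gx sep_x]; exists (chi q1 x), (chi q2 x), (chi q3 x).
by split=> //; exists x.
Qed.

End WreathGalois.

(** * Subfields of algC *)

Lemma QadjP s z :
  reflect (forall F : {pred algC}, divring_closed F -> {subset s <= F} -> z \in F)
          (z \in Qadj s).
Proof. exact: asboolP. Qed.

Lemma Qadj_divring_closed s : divring_closed (Qadj s).
Proof.
split=> [|u v /QadjP su /QadjP sv|u v /QadjP su /QadjP sv]; apply/QadjP=> F clF sF.
- by case: clF.
- by case: (clF) => _ clB _; rewrite clB ?su ?sv.
- by case: (clF) => _ _ clV; rewrite clV ?su ?sv.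
Qed.

HB.instance Definition _ s :=
  GRing.isDivringClosed.Build algC (Qadj s) (Qadj_divring_closed s).

Lemma mem_Qadj s : {subset s <= Qadj s}.
Proof. by move=> z sz; apply/QadjP=> F _; apply. Qed.

Lemma Qadj_sub s s' : {subset s <= Qadj s'} -> {subset Qadj s <= Qadj s'}.
Proof. by move=> ss' z /QadjP; apply=> //; apply: Qadj_divring_closed. Qed.

Lemma eq_Qadj s s' :
  {subset s <= Qadj s'} -> {subset s' <= Qadj s} -> Qadj s =i Qadj s'.
Proof. by move=> ss' s's z; apply/idP/idP; apply: Qadj_sub. Qed.

Lemma rpred_sqr_eq (F : divringClosed algC) u v :
  u ^+ 2 = v ^+ 2 -> v \in F -> u \in F.
Proof. by move/eqP; rewrite eqf_sqr => /pred2P[]-> //; rewrite rpredN. Qed.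

(** The roots of p are the z and their opposites, so the field generated by the z is a splitting
    field over Q; characteristic 0 makes it separable. *)
Lemma sqrt_splitting_field (s : seq algC) (p : {poly rat}) :
    map_poly ratr p = \prod_(z <- s) ('X^2 - (z ^+ 2)%:P) ->
  exists (L : splittingFieldType rat) (f : {rmorphism L -> algC}) (s1 : seq L),
    [/\ map f s1 = s, <<1 & s1>>%VS = fullv & galois 1 {:L}].
Proof.
move=> Dp; have [Qs [f [s1 Ds gen1]]] := num_field_exists s.
have ax : splitting_field_axiom Qs.
  exists (map_poly (in_alg Qs) p).
    apply/polyOverP=> i; rewrite coef_map /=; apply/vlineP; by exists p`_i.
  exists (s1 ++ map -%R s1); last first.
    apply/eqP; rewrite eqEsubv subvf /= -[X in (X <= _)%VS]gen1.
    by apply: adjoin_seqSr => z; rewrite mem_cat => ->.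
  suff -> : map_poly (in_alg Qs) p = \prod_(z <- s1 ++ map -%R s1) ('X - z%:P)
    by rewrite eqpxx.
  apply: (map_poly_inj f); rewrite -map_poly_comp.
  rewrite (@eq_map_poly _ _ _ ratr) => [|a]; last first.
    by rewrite /= alg_num_field fmorph_rat.
  rewrite Dp -Ds big_cat /= !big_map -big_split /= rmorph_prod.
  apply: eq_bigr => z _ /=.
  by rewrite [RHS]rmorphM /= !map_polyXsubC rmorphN polyCN polyC_exp /=; ring.
pose mix := FieldExt_isSplittingField.Build _ Qs ax.
pose L : splittingFieldType rat := HB.pack Qs mix.
exists L, f, s1; split=> //.
apply/and3P; split; [exact: sub1v | | exact: normalFieldf].
apply/separableP=> y _; apply: pcharf0_separable => q.
by rewrite pchar_lalg pchar_num.
Qed.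

(** The image of f is a subfield containing the generators; conversely an element of L is reached by
    polynomial evaluations, one generator at a time. *)
Lemma Qadj_image (L : fieldExtType rat) (f : {rmorphism L -> algC}) (s1 : seq L) :
  <<1 & s1>>%VS = fullv -> forall z, z \in Qadj (map f s1) <-> exists a, z = f a.
Proof.
move=> gen1 z; split=> [/QadjP/(_ (fun z => `[< exists a, z = f a >])) Kz | [a ->]].
  apply/asboolP/Kz => [|_ /mapP[a _ ->]]; last by apply/asboolP; exists a.
  split; first by apply/asboolP; exists 1; rewrite rmorph1.
    move=> _ _ /asboolP[a ->] /asboolP[b ->]; apply/asboolP.
    by exists (a - b); rewrite rmorphB.
  move=> _ _ /asboolP[a ->] /asboolP[b ->]; apply/asboolP.
  by exists (a / b); rewrite fmorph_div.
have genF (F : divringClosed algC) s b :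
    {subset map f s <= F} -> b \in <<1 & s>>%VS -> f b \in F.
  elim/last_ind: s b => [|s x IHs] b sF.
    rewrite Fadjoin_nil => /vlineP[c ->].
    by rewrite rmorphZ_num rmorph1 mulr1 rpred_rat.
  rewrite map_rcons in sF.
  rewrite adjoin_rcons => /Fadjoin_polyP[p /polyOverP sp ->].
  rewrite -horner_map rpred_horner ?sF ?mem_rcons ?mem_head //.
  apply/polyOverP=> i; rewrite coef_map /=; apply: IHs => [y sy|]; last exact: sp.
  by rewrite sF // mem_rcons in_cons sy orbT.
by apply: (genF (Qadj _) s1); [exact: mem_Qadj | rewrite gen1 memvf].
Qed.

Lemma eq_galois_with_group (K K' : {pred algC}) (gT : finGroupType)
    (G : {group gT}) :
  K =i K' -> galois_with_group K G -> galois_with_group K' G.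
Proof.
by move=> eqK [L [f [imK galL isoG]]]; exists L, f; split=> // z; rewrite -eqK.
Qed.

(** * Square roots of the four conjugates of theta *)

Definition sqrt_theta (p q : nat) (a b c d : rat) (i j : bool) : algC :=
  sqrtC ((ratr a + (-1) ^+ i * ratr b * sqrtC p%:R)
    + (-1) ^+ j * (ratr c + (-1) ^+ i * ratr d * sqrtC p%:R) * sqrtC q%:R).

Definition sqrt_thetas p q a b c d : seq algC :=
  [:: sqrt_theta p q a b c d false false; sqrt_theta p q a b c d false true;
      sqrt_theta p q a b c d true false; sqrt_theta p q a b c d true true].

(** The norm of T - theta, first along sqrt q, which gives A + B sqrt p, then along sqrt p, which
    gives A^2 - p B^2. The left side exhibits the rational coefficients. *)
Fact theta_norm (R S : comPzRingType) (m : {rmorphism R -> S})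
    (T a b c d p q : R) (s t : S) : m p = s ^+ 2 -> m q = t ^+ 2 ->
  m ((T ^+ 2 - 2 * a * T + (a ^+ 2 + p * b ^+ 2
      - q * (c ^+ 2 + p * d ^+ 2))) ^+ 2
    - p * (2 * a * b - 2 * q * c * d - 2 * b * T) ^+ 2) =
  (m T - (m a + 1 * m b * s + 1 * (m c + 1 * m d * s) * t))
  * ((m T - (m a + 1 * m b * s + -1 * (m c + 1 * m d * s) * t))
  * ((m T - (m a + -1 * m b * s + 1 * (m c + -1 * m d * s) * t))
  * (m T - (m a + -1 * m b * s + -1 * (m c + -1 * m d * s) * t)))).
Proof. by move=> mp mq; ring: mp mq. Qed.

Lemma sqrt_thetas_poly p q a b c d : exists P : {poly rat},
  map_poly ratr P =
    \prod_(z <- sqrt_thetas p q a b c d) ('X^2 - (z ^+ 2)%:P).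
Proof.
pose m : {rmorphism {poly rat} -> {poly algC}} := map_poly ratr.
have sqrtP n : m n%:R = (sqrtC n%:R)%:P ^+ 2.
  by rewrite rmorph_nat -polyC_exp sqrtCK polyC_natr.
have := theta_norm _ _ m 'X^2 a%:P b%:P c%:P d%:P _ _ _ _ (sqrtP p) (sqrtP q).
set P := (X in m X) => DP; exists P; rewrite -[LHS]/(m P) DP {DP P}.
rewrite /m /= !map_polyC map_polyXn /=.
rewrite !big_cons big_nil mulr1 /sqrt_theta !sqrtCK !(expr0, expr1).
by rewrite !(polyCD, polyCM, polyCN).
Qed.

Lemma sqrt_thetas_galois (p1 p2 p3 : nat) (a b c d w : rat)
    (r := sqrt_theta p1 p3 a b c d) (K := Qadj (sqrt_thetas p1 p3 a b c d)) :
    prime p1 -> prime p2 -> prime p3 -> p1 != p2 -> p1 != p3 -> p2 != p3 ->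
    w != 0 -> sqrtC p1%:R \in K -> sqrtC p3%:R \in K ->
    (r false false * r false true * (r true false * r true true)) ^+ 2 =
      ratr w ^+ 2 * p2%:R ->
  galois_with_group K N4F2.
Proof.
move=> pr1 pr2 pr3 ne12 ne13 ne23 w0 K1 K3 prod_r.
have [P /sqrt_splitting_field[L [f [s1 [Ds gen1 galL]]]]] :=
  sqrt_thetas_poly p1 p3 a b c d.
have imK := Qadj_image _ f _ gen1; rewrite Ds -/K in imK.
exists L, f; split=> //.
have [/imK[q1 Dq1] /imK[q3 Dq3]] := (K1, K3).
case: s1 Ds gen1 => [|r00 [|r01 [|r10 [|r11 []]]]] //= [D00 D01 D10 D11] gen1.
pose r' (i j : bool) : L :=
  if i then if j then r11 else r10 else if j then r01 else r00.
have fr i j : f (r' i j) = r i j by case: i; case: j.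
have fA u : f u%:A = ratr u by rewrite rmorphZ_num rmorph1 mulr1.
(* Taking the root of p2 from the product of the chosen roots makes [prod_r] hold in L with no sign
   ambiguity. *)
pose q2 : L := w^-1%:A *
  (r' false false * r' false true * (r' true false * r' true true)).
have w0C : ratr w != 0 :> algC by rewrite fmorph_eq0.
apply: (wreath_galois_isog L p1 p2 p3 pr1 pr2 pr3 ne12 ne13 ne23 q1 q2 q3 _ _ _
  a b c d w r') => //.
- by apply: (fmorph_inj f); rewrite rmorphXn rmorph_nat /= -Dq1 sqrtCK.
- apply: (fmorph_inj f); rewrite rmorphXn rmorph_nat /q2 !rmorphM fA !fr.
  by rewrite exprMn prod_r fmorphV exprVn mulKf ?expf_neq0.
- by apply: (fmorph_inj f); rewrite rmorphXn rmorph_nat /= -Dq3 sqrtCK.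
- move=> i j; apply: (fmorph_inj f); rewrite rmorphXn /= fr sqrtCK.
  by rewrite !(rmorphD, rmorphM, rmorph_sign) /= !fA -Dq1 -Dq3.
- move=> i j; rewrite -(fmorph_eq0 f) fr.
  have: (r false false * r false true * (r true false * r true true)) ^+ 2 != 0.
    by rewrite prod_r mulf_neq0 ?expf_neq0 // pnatr_eq0 -lt0n prime_gt0.
  rewrite expf_eq0 /= !mulf_eq0 !negb_or => /andP[/andP[? ?] /andP[? ?]].
  by case: i; case: j.
by rewrite /q2 !mulr_algl scalerA divff // scale1r.
Qed.

(** * Quadratic fields and their conjugation *)

Lemma rat_mul_sqr (n : nat) (u v : rat) :
  prime n -> v != 0 -> u ^+ 2 = n%:R * v ^+ 2 -> False.
Proof.
move=> n_pr v0 eq_uv; have := rat_sqr_logn n n (u / v) n_pr.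
rewrite expr_div_n eq_uv mulfK ?expf_neq0 // => /(_ erefl).
by rewrite logn_prime ?eqxx.
Qed.

Section QuadraticField.

Variables (p : nat) (pr_p : prime p).
Let q : algC := sqrtC p%:R.

Lemma quad_eq0 (a b : rat) : ratr a + ratr b * q = 0 -> a = 0 /\ b = 0.
Proof.
move=> ab0; have aE : (ratr a : algC) = - (ratr b * q).
  by apply/eqP; rewrite -addr_eq0 ab0.
have b0 : b = 0.
  apply/eqP; apply/contraT=> nz_b; exfalso; apply: (rat_mul_sqr p a b) => //.
  apply: (fmorph_inj (ratr : {rmorphism rat -> algC})).
  by rewrite [in RHS]rmorphM !rmorphXn rmorph_nat /= aE sqrrN exprMn sqrtCK mulrC.
by move/eqP: aE; rewrite b0 rmorph0 mul0r oppr0 fmorph_eq0 => /eqP.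
Qed.

Lemma quad_inj (a b a' b' : rat) :
  ratr a + ratr b * q = ratr a' + ratr b' * q -> a = a' /\ b = b'.
Proof.
move=> eq_ab; have [] := quad_eq0 (a - a') (b - b'); last first.
  by move=> /subr0_eq-> /subr0_eq->.
by rewrite !rmorphB /= mulrBl addrACA -opprD eq_ab subrr.
Qed.

Lemma Qadj_sqrtP z :
  z \in Qadj [:: q] -> exists a b : rat, z = ratr a + ratr b * q.
Proof.
move/QadjP/(_ (fun z => `[< exists a b : rat, z = ratr a + ratr b * q >])) => Kz.
apply/asboolP/Kz => [|_ /predU1P[-> | //]]; last first.
  by apply/asboolP; exists 0, 1; rewrite rmorph0 rmorph1 add0r mul1r.
have qE : q ^+ 2 = p%:R by exact: sqrtCK.
split; first by apply/asboolP; exists 1, 0; rewrite rmorph1 rmorph0 mul0r addr0.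
  move=> _ _ /asboolP[a [b ->]] /asboolP[c [d ->]]; apply/asboolP.
  by exists (a - c), (b - d); rewrite !rmorphB /=; ring.
move=> _ _ /asboolP[a [b ->]] /asboolP[c [d ->]]; apply/asboolP.
pose n := c ^+ 2 - p%:R * d ^+ 2.
have nE : ratr n = (ratr c + ratr d * q) * (ratr c - ratr d * q).
  by rewrite /n; ring: qE.
exists ((a * c - p%:R * b * d) / n), ((b * c - a * d) / n).
(* The norm vanishes only at c = d = 0, where both sides are 0 because the inverse of 0 is 0. *)
have [n0 | n0] := eqVneq n 0.
  rewrite n0 invr0 !mulr0 rmorph0 mul0r addr0; apply/eqP.
  rewrite mulf_eq0 invr_eq0; apply/orP; right; apply/eqP.
  move/eqP: nE; rewrite n0 rmorph0 eq_sym mulf_eq0 => /orP[/eqP // | /eqP].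
  rewrite -mulNr -rmorphN => /quad_eq0[-> /eqP]; rewrite oppr_eq0 => /eqP->.
  by rewrite rmorph0 mul0r addr0.
have nC : (ratr n : algC) != 0 by rewrite fmorph_eq0.
have := nC; rewrite nE mulf_eq0 => /norP[nz1 nz2].
apply: (mulIf nC); rewrite !fmorph_div /= [in RHS]mulrDl (mulfVK nC).
rewrite [in X in _ = _ + X]mulrAC (mulfVK nC) nE.
by rewrite mulrA mulfVK //; ring: qE.
Qed.

(** Coordinates in the basis 1, sqrt p are unique, so the choice made in [qconj] returns a and b. *)
Lemma qconjE (a b : rat) : qconj p (ratr a + ratr b * q) = ratr a - ratr b * q.
Proof.
rewrite /qconj; case: pselect => [h | []]; last by exists (a, b).
by have /eqP/quad_inj[Da Db] := xchooseP h; rewrite -Da -Db.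
Qed.

End QuadraticField.

(** * The field of the square roots of the thetas *)

Section SqrtMembership.

Variable F : divringClosed algC.

(** The two sides agree up to a sign, which a subfield does not see. *)
Lemma sqrtC_mul_in u v : sqrtC u \in F -> sqrtC v \in F -> sqrtC (u * v) \in F.
Proof.
move=> Fu Fv; apply: (rpred_sqr_eq F _ (sqrtC u * sqrtC v)); last exact: rpredM.
by rewrite exprMn !sqrtCK.
Qed.

Lemma sqrtC_div_in u v :
  u != 0 -> sqrtC u \in F -> sqrtC (u * v) \in F -> sqrtC v \in F.
Proof.
move=> u0 Fu Fuv; apply: (rpred_sqr_eq F _ (sqrtC (u * v) / sqrtC u)).
  by rewrite expr_div_n !sqrtCK mulrC mulKf.
exact: rpred_div.
Qed.

(* (sqrt (X + n) +- sqrt (X - n))^2 = 2 X +- 2 m when X^2 - n^2 = m^2. *)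
Lemma sqrtC_sum_in X m n : X ^+ 2 = m ^+ 2 + n ^+ 2 ->
  sqrtC (X + n) \in F -> sqrtC (X - n) \in F -> sqrtC (2 * X + 2 * m) \in F.
Proof.
move=> Xmn; set A := sqrtC (X + n); set B := sqrtC (X - n) => FA FB.
have [A2 B2] : A ^+ 2 = X + n /\ B ^+ 2 = X - n by rewrite !sqrtCK.
have /eqP : (A * B) ^+ 2 = m ^+ 2 by rewrite exprMn A2 B2; ring: Xmn.
(* The chosen roots satisfy A B = m or A B = -m; the root sought is then, up to sign, A + B or A -
   B. *)
rewrite eqf_sqr => /pred2P[] ABm.
  apply: (rpred_sqr_eq F _ (A + B)); last exact: rpredD.
  by rewrite sqrtCK -ABm sqrrD A2 B2; ring.
have {ABm} mE : m = - (A * B) by rewrite ABm opprK.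
apply: (rpred_sqr_eq F _ (A - B)); last exact: rpredB.
by rewrite sqrtCK mE sqrrB A2 B2; ring.
Qed.

(** [sqrtC_sum_in] for (2X, 2n, 2m), with m and n exchanged, gives a root of 4 (X + n). *)
Lemma sqrtC_sum_inV X m n : X ^+ 2 = m ^+ 2 + n ^+ 2 ->
    sqrtC (2 * X + 2 * m) \in F -> sqrtC (2 * X - 2 * m) \in F ->
  sqrtC (X + n) \in F.
Proof.
move=> Xmn Fp Fm.
have F4 : sqrtC (2 * (2 * X) + 2 * (2 * n)) \in F.
  by apply: sqrtC_sum_in Fp Fm; ring: Xmn.
apply: (rpred_sqr_eq F _ (sqrtC (2 * (2 * X) + 2 * (2 * n)) / 2)).
  rewrite expr_div_n !sqrtCK.
  have -> : 2 * (2 * X) + 2 * (2 * n) = (X + n) * 2 ^+ 2 :> algC by ring.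
  by rewrite mulfK // expf_neq0 // pnatr_eq0.
by apply: rpred_div => //; apply: rpred_nat.
Qed.

End SqrtMembership.

Section ThetaField.

Variables (p1 p2 p3 : nat).
Hypotheses (pr1 : prime p1) (pr2 : prime p2) (pr3 : prime p3).
Hypotheses (ne12 : p1 != p2) (ne13 : p1 != p3) (ne23 : p2 != p3).
Variables (a b c d g h x y z : rat).

Let q1 : algC := sqrtC p1%:R.
Let q2 : algC := sqrtC p2%:R.
Let q3 : algC := sqrtC p3%:R.
Let X := ratr a + ratr b * q1.
Let Y := ratr c + ratr d * q1.
Let Z := ratr g + ratr h * q1.
Let alpha := ratr x + ratr y * q1.
Let Xc := ratr a - ratr b * q1.
Let Yc := ratr c - ratr d * q1.
Let Zc := ratr g - ratr h * q1.
Let alphac := ratr x - ratr y * q1.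

Hypothesis norm_alpha : x ^+ 2 - p1%:R * y ^+ 2 = p2%:R * z ^+ 2.
Hypothesis z0 : z != 0.
Hypothesis XYZ : X ^+ 2 - p3%:R * Y ^+ 2 = alpha * Z ^+ 2.
Hypothesis YZ0 : Y != 0 \/ Z != 0.

Let q1E : q1 ^+ 2 = p1%:R. Proof. exact: sqrtCK. Qed.
Let q2E : q2 ^+ 2 = p2%:R. Proof. exact: sqrtCK. Qed.
Let q3E : q3 ^+ 2 = p3%:R. Proof. exact: sqrtCK. Qed.

Let quad_in (F : divringClosed algC) (u v : rat) :
  q1 \in F -> ratr u + ratr v * q1 \in F.
Proof.
by move=> Fq; apply: rpredD; last apply: rpredM; rewrite ?rpred_rat.
Qed.

Let conj_neq0 (u v : rat) : ratr u + ratr v * q1 != 0 -> ratr u - ratr v * q1 != 0.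
Proof.
apply: contra_neq; rewrite -mulNr -rmorphN => /(quad_eq0 _ pr1)[-> /eqP].
by rewrite oppr_eq0 => /eqP->; rewrite rmorph0 mul0r addr0.
Qed.

(** The two sides of [XYZ] differ by u + v sqrt p1, so u = v = 0; the conjugate sides differ by u -
    v sqrt p1. *)
Lemma theta_conj_eq : Xc ^+ 2 - p3%:R * Yc ^+ 2 = alphac * Zc ^+ 2.
Proof.
pose u : rat := a ^+ 2 + p1%:R * b ^+ 2 - p3%:R * (c ^+ 2 + p1%:R * d ^+ 2)
  - (x * (g ^+ 2 + p1%:R * h ^+ 2) + 2 * y * g * h * p1%:R).
pose v : rat := 2 * a * b - 2 * p3%:R * c * d
  - (2 * x * g * h + y * (g ^+ 2 + p1%:R * h ^+ 2)).
have [] := quad_eq0 _ pr1 u v.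
  transitivity (X ^+ 2 - p3%:R * Y ^+ 2 - alpha * Z ^+ 2); last by rewrite XYZ subrr.
  by rewrite /X /Y /Z /alpha /u /v -/q1; ring: q1E.
move=> u0 v0; apply/eqP; rewrite -subr_eq0; apply/eqP.
transitivity (ratr u - ratr v * q1); last by rewrite u0 v0 rmorph0 mul0r subrr.
by rewrite /Xc /Yc /Zc /alphac /u /v; ring: q1E.
Qed.

Lemma alpha_norm : alpha * alphac = p2%:R * ratr z ^+ 2.
Proof.
have := congr1 (ratr : rat -> algC) norm_alpha => normC.
transitivity (ratr (p2%:R * z ^+ 2) : algC); last by ring.
by rewrite -normC /alpha /alphac; ring: q1E.
Qed.

(** If Z = 0, then p3 is the square of X / Y = u + v sqrt p1, so u v = 0 and p3 or p1 p3 is a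
    rational square. *)
Lemma theta_Z_neq0 : Z != 0.
Proof.
case: YZ0 => // Y0; apply/eqP=> Z0; move: XYZ; rewrite Z0 expr0n mulr0 => XY.
have [u [v Duv]] : exists u v, X / Y = ratr u + ratr v * q1.
  have Kq : q1 \in Qadj [:: q1] by apply/mem_Qadj/mem_head.
  by apply: Qadj_sqrtP => //; apply: rpred_div; apply: quad_in.
have p3E : p3%:R = (X / Y) ^+ 2.
  by move/subr0_eq: XY => XY; rewrite expr_div_n XY mulfK // expf_neq0.
have [] := quad_eq0 _ pr1 (u ^+ 2 + p1%:R * v ^+ 2 - p3%:R) (2 * u * v).
  transitivity ((ratr u + ratr v * q1) ^+ 2 - p3%:R); last first.
    by rewrite -Duv p3E subrr.
  by rewrite -/q1; ring: q1E.
move=> uv3 /eqP; rewrite !mulf_eq0 pnatr_eq0 /= => /orP[]/eqP w0.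
  suff /(rat_sqr_logn p1 _ _ pr1): (p1%:R * v) ^+ 2 = (p1 * p3)%:R.
    by rewrite lognM ?prime_gt0 // !logn_prime // eqxx (negPf ne13).
  rewrite natrM exprMn; move: uv3; rewrite w0 expr0n add0r => /subr0_eq <-; ring.
suff /(rat_sqr_logn p3 _ _ pr3): u ^+ 2 = p3%:R by rewrite logn_prime ?eqxx.
by move: uv3; rewrite w0 expr0n mulr0 addr0 => /subr0_eq.
Qed.

(** w = z N(Z), so that the product of the four thetas, N(alpha) N(Z)^2, is p2 w^2. *)
Let w : rat := z * (g ^+ 2 - p1%:R * h ^+ 2).

Let wE : ratr w = ratr z * (Z * Zc).
Proof. by rewrite /w /Z /Zc; ring: q1E. Qed.

Let w_neq0 : w != 0.
Proof.
have: ratr w != 0 :> algC; last by rewrite fmorph_eq0.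
rewrite wE; apply: mulf_neq0; first by rewrite fmorph_eq0.
by apply: mulf_neq0; last apply: conj_neq0; apply: theta_Z_neq0.
Qed.

Let prod_alphaZ : alpha * Z ^+ 2 * (alphac * Zc ^+ 2) = ratr w ^+ 2 * p2%:R.
Proof.
transitivity (alpha * alphac * (Z * Zc) ^+ 2); first by ring.
by rewrite alpha_norm wE; ring.
Qed.

(** If Y = 0, the norm of X^2 = alpha Z^2 reads N(X)^2 = p2 w^2, which is impossible in Q. *)
Lemma theta_Y_neq0 : Y != 0.
Proof.
apply/eqP=> Y0; have Yc0 : Yc = 0.
  by move/(quad_eq0 _ pr1): Y0 => [c0 d0]; rewrite /Yc c0 d0 rmorph0 mul0r subrr.
apply: (rat_mul_sqr p2 (a ^+ 2 - p1%:R * b ^+ 2) w) => //.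
apply: (fmorph_inj (ratr : {rmorphism rat -> algC})).
transitivity (X ^+ 2 * Xc ^+ 2); first by rewrite /X /Xc; ring: q1E.
move: XYZ theta_conj_eq; rewrite Y0 Yc0 expr0n mulr0 !subr0 => -> ->.
by rewrite prod_alphaZ; ring.
Qed.

Let rs := [:: sqrtC (X + Y * q3); sqrtC (X - Y * q3);
              sqrtC (Xc + Yc * q3); sqrtC (Xc - Yc * q3)].

Let rsE : rs = sqrt_thetas p1 p3 a b c d.
Proof.
by rewrite /sqrt_thetas /sqrt_theta /= !(expr0, expr1, mul1r, mulN1r, mulNr).
Qed.

Let rs_theta u : sqrtC u \in rs -> u \in Qadj rs.
Proof. by move=> rs_u; rewrite -[u]sqrtCK rpredX // mem_Qadj. Qed.

Let theta12 : (X + Y * q3) * (X - Y * q3) = alpha * Z ^+ 2.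
Proof. by rewrite -XYZ; ring: q3E. Qed.

Let theta34 : (Xc + Yc * q3) * (Xc - Yc * q3) = alphac * Zc ^+ 2.
Proof. by rewrite -theta_conj_eq; ring: q3E. Qed.

Let prod_rs : (sqrtC (X + Y * q3) * sqrtC (X - Y * q3) *
  (sqrtC (Xc + Yc * q3) * sqrtC (Xc - Yc * q3))) ^+ 2 = ratr w ^+ 2 * p2%:R.
Proof. by rewrite -prod_alphaZ -theta12 -theta34 !exprMn !sqrtCK. Qed.

(** The product of the first two thetas, alpha Z^2 = u + v sqrt p1, lies in the field. If v = 0, its
    norm gives u^2 = p2 w^2; hence v is nonzero and sqrt p1 can be solved for. *)
Lemma theta_sqrt1 : q1 \in Qadj rs.
Proof.
have K12 : alpha * Z ^+ 2 \in Qadj rs.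
  by rewrite -theta12 rpredM // rs_theta // !inE eqxx ?orbT.
pose u : rat := x * (g ^+ 2 + p1%:R * h ^+ 2) + 2 * y * g * h * p1%:R.
pose v : rat := 2 * x * g * h + y * (g ^+ 2 + p1%:R * h ^+ 2).
have uvE : alpha * Z ^+ 2 = ratr u + ratr v * q1.
  by rewrite /alpha /Z /u /v; ring: q1E.
have uvcE : alphac * Zc ^+ 2 = ratr u - ratr v * q1.
  by rewrite /alphac /Zc /u /v; ring: q1E.
have [v0 | v0] := eqVneq v 0.
  exfalso; apply: (rat_mul_sqr p2 u w) => //.
  apply: (fmorph_inj (ratr : {rmorphism rat -> algC})).
  transitivity (alpha * Z ^+ 2 * (alphac * Zc ^+ 2)).
    by rewrite uvE uvcE v0; ring.
  by rewrite prod_alphaZ; ring.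
have v0C : ratr v != 0 :> algC by rewrite fmorph_eq0.
have -> : q1 = (alpha * Z ^+ 2 - ratr u) / ratr v.
  by rewrite uvE addrAC subrr add0r mulrAC divff // mul1r.
by rewrite rpred_div ?rpredB ?rpred_rat.
Qed.

Lemma theta_sqrt3 : q3 \in Qadj rs.
Proof.
have -> : q3 = ((X + Y * q3) - (X - Y * q3)) / (2 * Y).
  have -> : X + Y * q3 - (X - Y * q3) = q3 * (2 * Y) by ring.
  by rewrite mulfK // mulf_neq0 ?pnatr_eq0 ?theta_Y_neq0.
apply: rpred_div.
  by apply: rpredB; apply: rs_theta; rewrite !inE eqxx ?orbT.
by apply: rpredM; [exact: rpred_nat | apply/quad_in/theta_sqrt1].
Qed.

Lemma theta_sqrt2 : q2 \in Qadj rs.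
Proof.
have w0C : ratr w != 0 :> algC by rewrite fmorph_eq0.
apply: (rpred_sqr_eq (Qadj rs) q2
  (sqrtC (X + Y * q3) * sqrtC (X - Y * q3) *
   (sqrtC (Xc + Yc * q3) * sqrtC (Xc - Yc * q3)) / ratr w)).
  rewrite expr_div_n prod_rs q2E.
  by rewrite [ratr w ^+ 2 * _]mulrC mulfK ?expf_neq0.
apply: rpred_div; last exact: rpred_rat.
by apply: rpredM; apply: rpredM; apply: mem_Qadj; rewrite !inE eqxx ?orbT.
Qed.

Lemma theta_galois : galois_with_group (Qadj rs) N4F2.
Proof.
move: theta_sqrt1 theta_sqrt3; rewrite rsE => K1 K3.
apply: (sqrt_thetas_galois p1 p2 p3 a b c d w) => //.
by case: rsE => <- <- <- <-; apply: prod_rs.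
Qed.

Lemma theta_field_eq : Qadj [:: q1; q2; q3; sqrtC ((X + Y * q3) * (X - Y * q3));
    sqrtC ((X + Y * q3) * (Xc + Yc * q3)); sqrtC (X + Y * q3)] =i Qadj rs.
Proof.
have alpha0 : alpha * alphac != 0.
  rewrite alpha_norm mulf_neq0 ?expf_neq0 ?fmorph_eq0 //.
  by rewrite pnatr_eq0 -lt0n prime_gt0.
move: alpha0; rewrite mulf_eq0 => /norP[alpha0 alphac0].
have Z0 := theta_Z_neq0; have Zc0 : Zc != 0 by apply: conj_neq0.
have th12 : (X + Y * q3) * (X - Y * q3) != 0.
  by rewrite theta12 mulf_neq0 ?expf_neq0.
have th34 : (Xc + Yc * q3) * (Xc - Yc * q3) != 0.
  by rewrite theta34 mulf_neq0 ?expf_neq0.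
set gens := (X in Qadj X); pose K := Qadj gens; apply: eq_Qadj => u.
  have Krs v : v \in rs -> v \in Qadj rs by apply: mem_Qadj.
  rewrite !inE => /or4P[/eqP-> | /eqP-> | /eqP-> | /or3P[]/eqP->].
  - exact: theta_sqrt1.
  - exact: theta_sqrt2.
  - exact: theta_sqrt3.
  - by apply: sqrtC_mul_in; apply: Krs; rewrite !inE eqxx ?orbT.
  - by apply: sqrtC_mul_in; apply: Krs; rewrite !inE eqxx ?orbT.
  - by apply: Krs; rewrite !inE eqxx.
have KsE v : v \in gens -> v \in K by apply: mem_Qadj.
have K1 : sqrtC (X + Y * q3) \in K by apply: KsE; rewrite !inE eqxx !orbT.
have K12 : sqrtC ((X + Y * q3) * (X - Y * q3)) \in K.
  by apply: KsE; rewrite !inE eqxx !orbT.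
have K13 : sqrtC ((X + Y * q3) * (Xc + Yc * q3)) \in K.
  by apply: KsE; rewrite !inE eqxx !orbT.
have Kq2 : q2 \in K by apply: KsE; rewrite !inE eqxx !orbT.
move: (th12) (th34); rewrite !mulf_eq0 => /norP[th1 th2] /norP[th3 th4].
have K2 : sqrtC (X - Y * q3) \in K by apply: sqrtC_div_in K1 K12.
have K3 : sqrtC (Xc + Yc * q3) \in K by apply: sqrtC_div_in K1 K13.
(* The four thetas multiply to (w sqrt p2)^2, so sqrt p2 and the root of the first pair give that of
   the second pair. *)
have K34 : sqrtC ((Xc + Yc * q3) * (Xc - Yc * q3)) \in K.
  apply: sqrtC_div_in th12 K12 _.
  apply: (rpred_sqr_eq K _ (ratr w * q2)); last by rewrite rpredM ?rpred_rat.
  by rewrite exprMn sqrtCK theta12 theta34 prod_alphaZ q2E.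
have K4 : sqrtC (Xc - Yc * q3) \in K by apply: sqrtC_div_in K3 K34.
by rewrite !inE => /or4P[]/eqP->.
Qed.

Lemma theta_field :
  [/\ Y != 0, Yc != 0 & Xc ^+ 2 - p3%:R * Yc ^+ 2 = alphac * Zc ^+ 2] /\
  [/\ q1 \in Qadj rs, q2 \in Qadj rs, q3 \in Qadj rs,
      Qadj [:: q1; q2; q3; sqrtC ((X + Y * q3) * (X - Y * q3));
               sqrtC ((X + Y * q3) * (Xc + Yc * q3)); sqrtC (X + Y * q3)]
        =i Qadj rs
    & galois_with_group (Qadj rs) N4F2].
Proof.
split; first by split; [| apply: conj_neq0 |];
  first [exact: theta_Y_neq0 | exact: theta_conj_eq].
split; [exact: theta_sqrt1 | exact: theta_sqrt2 | exact: theta_sqrt3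
       | exact: theta_field_eq | exact: theta_galois].
Qed.

End ThetaField.

(** * Application to the given solutions *)

(** With z = 0, irrationality of sqrt p forces x = y = 0, against the gcd condition. *)
Lemma redei_solution_neq0 p q x y z :
  prime p -> redei_solution p q x y z -> z != 0.
Proof.
move=> pr_p [xyz gcd1 _ _]; apply/eqP=> z0; move: xyz.
rewrite z0 expr0n mulr0 subr0 => /subr0_eq xy; have [y0 | y0] := eqVneq y 0.
  move/eqP: xy; rewrite y0 expr0n mulr0 sqrf_eq0 => /eqP x0.
  by move: gcd1; rewrite x0 y0 z0.
apply: (rat_mul_sqr p x%:~R y%:~R) => //; first by rewrite intr_eq0.
by rewrite -!rmorphXn /= xy rmorphM.
Qed.

Lemma legendre1_neq (p q : nat) : legendre p q = 1 -> p != q.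
Proof. by apply: contra_eq_neq => ->; rewrite /legendre dvdnn. Qed.

Theorem theorem3p1p8 (p1 p2 p3 : nat) (P2 : {pred algC}) (x y z : int)
    (m : nat) (X Y Z : algC) :
  let sq1 := sqrtC (p1%:R : algC) in
  let sq2 := sqrtC (p2%:R : algC) in
  let sq3 := sqrtC (p3%:R : algC) in
  let k := Qadj [:: sq1] in
  let alpha : algC := x%:~R + y%:~R * sq1 in
  let k13 := Qadj [:: sq1; sq3] in
  let k13' := Qadj [:: sq1; sqrtC alpha] in
  let Xc := qconj p1 X in
  let Yc := qconj p1 Y in
  let Zc := qconj p1 Z in
  let alphac := qconj p1 alpha in
  let theta1 := X + Y * sq3 in
  let theta2 := X - Y * sq3 in
  let theta3 := Xc + Yc * sq3 in
  let theta4 := Xc - Yc * sq3 in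
  let theta1' := X + Z * sqrtC alpha in
  let theta2' := X - Z * sqrtC alpha in
  let theta3' := Xc + Zc * sqrtC alphac in
  let theta4' := Xc - Zc * sqrtC alphac in
  let eta1 := 2 * X + 2 * Y * sq3 in
  let eta2 := 2 * X - 2 * Y * sq3 in
  let eta3 := 2 * Xc + 2 * Yc * sq3 in
  let eta4 := 2 * Xc - 2 * Yc * sq3 in
  let K := Qadj [:: sq1; sq2; sq3; sqrtC (theta1 * theta2);
                    sqrtC (theta1 * theta3); sqrtC theta1] in
  let K' := Qadj [:: sq1; sq2; sq3; sqrtC (theta1' * theta2');
                     sqrtC (theta1' * theta3'); sqrtC theta1'] in
  (forall p, p \in [:: p1; p2; p3] -> prime p /\ (p = 1 %[mod 4])%N) ->
  (forall p q r, perm_eq [:: p; q; r] [:: p1; p2; p3] ->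
     legendre p q = 1 /\ redei_symbol p q r = 1) ->
  (p1 = 5 %[mod 8])%N ->
  class_number_is k 1 ->
  prime_over k p2 P2 ->
  redei_solution p1 p2 x y z ->
  principal k alpha =i exp_ideal k P2 m ->
  odd m ->
  [/\ X \in ringint k, Y \in ringint k & Z \in ringint k] ->
  X ^+ 2 - p3%:R * Y ^+ 2 - alpha * Z ^+ 2 = 0 ->
  coprimeF k [:: X; Y; Z] ->
  (coprimeF k [:: Z; 2] /\
     exists2 lambda, lambda \in ringint k13
                   & eqmodF k13 4 (lambda ^+ 2) theta1) \/
  (coprimeF k [:: Y; 2] /\
     exists2 lambda, lambda \in ringint k13'
                   & eqmodF k13' 4 (lambda ^+ 2) theta1') ->
  (coprimeF k [:: Z; 2] ->
     K =i Qadj [:: sqrtC theta1; sqrtC theta2; sqrtC theta3; sqrtC theta4] /\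
     galois_with_group K N4F2)
  /\
  (coprimeF k [:: Y; 2] ->
     [/\ K' =i Qadj [:: sqrtC theta1'; sqrtC theta2';
                        sqrtC theta3'; sqrtC theta4'],
         K' =i Qadj [:: sqrtC eta1; sqrtC eta2; sqrtC eta3; sqrtC eta4]
       & galois_with_group K' N4F2]).
Proof.
move=> sq1 sq2 sq3 k alpha k13 k13' Xc Yc Zc alphac theta1 theta2 theta3 theta4.
move=> theta1' theta2' theta3' theta4' eta1 eta2 eta3 eta4 K K'.
move=> prs syms _ _ _ sol _ _ [/andP[kX _] /andP[kY _] /andP[kZ _]] XYZ cop _.
have [pr1 pr2 pr3] : [/\ prime p1, prime p2 & prime p3].
  by split; [have [] := prs p1 _ | have [] := prs p2 _ | have [] := prs p3 _];
    rewrite ?inE ?eqxx ?orbT.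
have ne12 : p1 != p2 by have [/legendre1_neq] := syms p1 p2 p3 (perm_refl _).
have ne13 : p1 != p3.
  have [|/legendre1_neq //] := syms p1 p3 p2.
  by rewrite perm_cons (perm_catC [:: p3] [:: p2]).
have ne23 : p2 != p3.
  have [|/legendre1_neq //] := syms p2 p3 p1.
  by rewrite (perm_catC [:: p2; p3] [:: p1]).
have z0 := redei_solution_neq0 _ _ _ _ _ pr1 sol.
have [a [b DX]] := Qadj_sqrtP _ pr1 _ kX.
have [c [d DY]] := Qadj_sqrtP _ pr1 _ kY.
have [g [h DZ]] := Qadj_sqrtP _ pr1 _ kZ.
have Dalpha : alpha = ratr x%:~R + ratr y%:~R * sq1 by rewrite !ratr_int.
have DXc : Xc = ratr a - ratr b * sq1 by rewrite /Xc DX qconjE.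
have DYc : Yc = ratr c - ratr d * sq1 by rewrite /Yc DY qconjE.
have DZc : Zc = ratr g - ratr h * sq1 by rewrite /Zc DZ qconjE.
have Dalphac : alphac = ratr x%:~R - ratr y%:~R * sq1.
  by rewrite /alphac Dalpha qconjE.
have norm_alpha : (x%:~R : rat) ^+ 2 - p1%:R * y%:~R ^+ 2 = p2%:R * z%:~R ^+ 2.
  case: sol => /subr0_eq normZ _ _ _; transitivity ((p2%:Z * z ^+ 2)%:~R : rat).
    by rewrite -normZ; ring.
  by ring.
have z0Q : (z%:~R : rat) != 0 by rewrite intr_eq0.
have XYZ' : X ^+ 2 - p3%:R * Y ^+ 2 = alpha * Z ^+ 2 by apply: subr0_eq.
have YZ0 : Y != 0 \/ Z != 0.
  apply/orP; rewrite -negb_and; apply/negP=> /andP[/eqP Y0 /eqP Z0].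
  have X0 : X = 0.
    move/eqP: XYZ'; rewrite Y0 Z0 expr0n !mulr0 subr0 sqrf_eq0 => /eqP-> //.
  (* If X = Y = Z = 0, then 0 is a common divisor, and coprimality would make 0 divide 1. *)
  have [|u|u _ /eqP] := cop 0.
  - by rewrite unfold_in /= !rpred0.
  - rewrite X0 Y0 Z0 !inE !orbb => /eqP->; exists 0; last by rewrite mulr0.
    by rewrite unfold_in /= !rpred0.
  by rewrite mul0r oner_eq0.
have := theta_field p1 p2 p3 pr1 pr2 pr3 ne12 ne13 ne23 a b c d g h
  _ _ _ norm_alpha z0Q.
rewrite -/sq1 -DX -DY -DZ -Dalpha -DXc -DYc -DZc -Dalphac.
move=> /(_ XYZ' YZ0)[[Y0 Yc0 XYZc] [_ _ _ eqK galK]].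
split=> [_ | _].
  by split=> //; apply: eq_galois_with_group galK => u; rewrite eqK.
have X2 : X ^+ 2 = p3%:R * Y ^+ 2 + alpha * Z ^+ 2 by rewrite -XYZ' subrKC.
have Xc2 : Xc ^+ 2 = p3%:R * Yc ^+ 2 + alphac * Zc ^+ 2 by rewrite -XYZc subrKC.
pose rs' := [:: sqrtC theta1'; sqrtC theta2'; sqrtC theta3'; sqrtC theta4'].
pose re := [:: sqrtC eta1; sqrtC eta2; sqrtC eta3; sqrtC eta4].
have [K1 K2 K3 galE] : [/\ sq1 \in Qadj re, sq2 \in Qadj re, sq3 \in Qadj re
    & galois_with_group (Qadj re) N4F2].
  have dbl u v : ratr (2 * u) + ratr (2 * v) * sq1 = 2 * (ratr u + ratr v * sq1).
    by ring.
  have dblc u v : ratr (2 * u) - ratr (2 * v) * sq1 = 2 * (ratr u - ratr v * sq1).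
    by ring.
  (* The eta are the thetas of the solution (2X, 2Y, 2Z) for the same alpha. *)
  have := theta_field p1 p2 p3 pr1 pr2 pr3 ne12 ne13 ne23 (2 * a) (2 * b) (2 * c)
    (2 * d) (2 * g) (2 * h) _ _ _ norm_alpha z0Q.
  rewrite -/sq1 !dbl !dblc -DX -DY -DZ -Dalpha -DXc -DYc -DZc -Dalphac.
  case; first by ring: X2.
    by left; rewrite mulf_neq0 ?pnatr_eq0.
  by move=> _ [].
have sum1 : X ^+ 2 = (Y * sq3) ^+ 2 + (Z * sqrtC alpha) ^+ 2.
  have [s3 sa] := (sqrtCK (p3%:R : algC), sqrtCK alpha).
  by rewrite -/sq3 in s3; ring: X2 s3 sa.
have sum2 : Xc ^+ 2 = (Yc * sq3) ^+ 2 + (Zc * sqrtC alphac) ^+ 2.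
  have [s3 sa] := (sqrtCK (p3%:R : algC), sqrtCK alphac).
  by rewrite -/sq3 in s3; ring: Xc2 s3 sa.
(* Negating one term turns a statement about the first member of a pair of theta' or eta into one
   about the second. *)
have sgn_sum (u v w : algC) : u ^+ 2 = v ^+ 2 + w ^+ 2 ->
  u ^+ 2 = (- v) ^+ 2 + w ^+ 2 /\ u ^+ 2 = v ^+ 2 + (- w) ^+ 2.
  by rewrite !sqrrN.
have [[sum1m sum1n] [sum2m sum2n]] := (sgn_sum _ _ _ sum1, sgn_sum _ _ _ sum2).
have eqE : Qadj rs' =i Qadj re.
  apply: eq_Qadj => u; rewrite !inE.
    have Ke v : v \in re -> v \in Qadj re by apply: mem_Qadj.
    case/or4P=> /eqP->.
    - by apply: (sqrtC_sum_inV _ _ _ _ sum1);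
        rewrite mulrA; apply: Ke; rewrite !inE eqxx ?orbT.
    - by apply: (sqrtC_sum_inV _ _ _ _ sum1n);
        rewrite mulrA; apply: Ke; rewrite !inE eqxx ?orbT.
    - by apply: (sqrtC_sum_inV _ _ _ _ sum2);
        rewrite mulrA; apply: Ke; rewrite !inE eqxx ?orbT.
    - by apply: (sqrtC_sum_inV _ _ _ _ sum2n);
        rewrite mulrA; apply: Ke; rewrite !inE eqxx ?orbT.
  have Kr v : v \in rs' -> v \in Qadj rs' by apply: mem_Qadj.
  have De1 : eta1 = 2 * X + 2 * (Y * sq3) by rewrite mulrA.
  have De2 : eta2 = 2 * X + 2 * - (Y * sq3) by rewrite mulrN mulrA.
  have De3 : eta3 = 2 * Xc + 2 * (Yc * sq3) by rewrite mulrA.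
  have De4 : eta4 = 2 * Xc + 2 * - (Yc * sq3) by rewrite mulrN mulrA.
  rewrite De1 De2 De3 De4.
  case/or4P=> /eqP->.
  - by apply: (sqrtC_sum_in _ _ _ _ sum1); apply: Kr; rewrite !inE eqxx ?orbT.
  - by apply: (sqrtC_sum_in _ _ _ _ sum1m); apply: Kr; rewrite !inE eqxx ?orbT.
  - by apply: (sqrtC_sum_in _ _ _ _ sum2); apply: Kr; rewrite !inE eqxx ?orbT.
  - by apply: (sqrtC_sum_in _ _ _ _ sum2m); apply: Kr; rewrite !inE eqxx ?orbT.
have sq3_neq0 : sq3 != 0 by rewrite sqrtC_eq0 pnatr_eq0 -lt0n prime_gt0.
have th12 : theta1' * theta2' = (Y * sq3) ^+ 2.
  by rewrite /theta1' /theta2'; ring: sum1.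
have th34 : theta3' * theta4' = (Yc * sq3) ^+ 2.
  by rewrite /theta3' /theta4'; ring: sum2.
have eqK' : K' =i Qadj rs'.
  apply: eq_Qadj => u; rewrite !inE.
    have Kr v : v \in rs' -> v \in Qadj rs' by apply: mem_Qadj.
    case/or4P=> [/eqP-> | /eqP-> | /eqP-> | /or3P[]/eqP->]; rewrite ?eqE //.
    - by rewrite -eqE; apply: sqrtC_mul_in; apply: Kr; rewrite !inE eqxx ?orbT.
    - by rewrite -eqE; apply: sqrtC_mul_in; apply: Kr; rewrite !inE eqxx ?orbT.
    - by rewrite -eqE; apply: Kr; rewrite !inE eqxx.
  set gens := [:: sq1; _; _; _; _; _] in K'.
  have KK v : v \in gens -> v \in K' by apply: mem_Qadj.
  have Ksq1 : sq1 \in K' by apply: KK; rewrite !inE eqxx.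
  have Ksq3 : sq3 \in K' by apply: KK; rewrite !inE eqxx !orbT.
  have Kt1 : sqrtC theta1' \in K' by apply: KK; rewrite !inE eqxx !orbT.
  have Kt12 : sqrtC (theta1' * theta2') \in K'.
    by apply: KK; rewrite !inE eqxx !orbT.
  have Kt13 : sqrtC (theta1' * theta3') \in K'.
    by apply: KK; rewrite !inE eqxx !orbT.
  have: theta1' * theta2' != 0 by rewrite th12 expf_neq0 // mulf_neq0.
  rewrite mulf_eq0 => /norP[t1 t2].
  have: theta3' * theta4' != 0 by rewrite th34 expf_neq0 // mulf_neq0.
  rewrite mulf_eq0 => /norP[t3 t4].
  have Kt2 : sqrtC theta2' \in K' by apply: sqrtC_div_in t1 Kt1 Kt12.
  have Kt3 : sqrtC theta3' \in K' by apply: sqrtC_div_in t1 Kt1 Kt13.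
  (* A root of theta3' theta4' is plus or minus Yc sqrt p3, already in K' through sqrt p1 and sqrt
     p3. *)
  have Kt4 : sqrtC theta4' \in K'.
    apply: sqrtC_div_in t3 Kt3 _; apply: (rpred_sqr_eq K' _ (Yc * sq3)).
      by rewrite sqrtCK.
    apply: rpredM => //; rewrite DYc; apply: rpredB; first exact: rpred_rat.
    by apply: rpredM => //; apply: rpred_rat.
  by case/or4P=> /eqP->.
have eqKE : K' =i Qadj re by move=> u; rewrite eqK' eqE.
by split=> //; apply: eq_galois_with_group galE => u; rewrite eqKE.
Qed.
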